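(* Let $\Gamma$ be a finitely generated group with a fixed finite symmetric generating set, let $g\in\Gamma$ be a non-central element with centralizer $C=C_\Gamma(g)$, and suppose that for every $\gamma\in\Gamma\setminus C$, $$\lim_{n\to\infty}\frac{\rho(3n)^2\,\alpha_{C\cap\gamma C\gamma^{-1}}(2n)}{\alpha_C(n)}=0 .$$ If $\mathcal{H}\subset\mathrm{Sub}(\Gamma)$ is an amenable uniformly recurrent subgroup (URS), then $g\notin H$ for all $H\in\mathcal{H}$.
   Context: Let $B_n(\Gamma)$ be the ball of radius $n$ around the identity for the word length of the fixed generating set. Let $\lambda$ be the left regular representation of $\Gamma$ on $\ell^2(\Gamma)$, extended linearly to the group algebra $\mathbb{C}\Gamma$, let $\|\lambda(f)\|$ denote the operator norm, and let $\|f\|_2$ be the $\ell^2$-norm. Define $$\rho(n)=\max\left\{\frac{\|\lambda(f)\|}{\|f\|_2}: 0\neq f\in\mathbb{C}\Gamma,\ \mathrm{supp}(f)\subseteq B_n(\Gamma)\right\}.$$ For a subset $A\subseteq\Gamma$, its growth function is $\alpha_A(n)=|A\cap B_n(\Gamma)|$. $\mathrm{Sub}(\Gamma)$ is the compact space of subgroups of $\Gamma$ with the Chabauty topology (the topology induced from the product topology on $\{0,1\}^\Gamma$), on which $\Gamma$ acts by conjugation. A URS (Glasner–Weiss) is a nonempty closed $\Gamma$-invariant subset $\mathcal{H}\subset\mathrm{Sub}(\Gamma)$ on which the conjugation action is minimal. It is amenable if every $H\in\mathcal{H}$ is amenable. *)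

(* Defs.v *)
From HB Require Import structures.
From mathcomp Require Import all_boot all_order all_algebra finmap.
From mathcomp Require Import all_classical all_reals all_analysis.
From mathcomp Require Import complex.

Set Implicit Arguments.
Unset Strict Implicit.
Unset Printing Implicit Defensive.

Import Order.TTheory GRing.Theory Num.Theory.
Import numFieldNormedType.Exports.

Local Open Scope classical_set_scope.
Local Open Scope ring_scope.

Section WordMetric.
Variables (G : groupType) (S : set G).

Definition symmetric_set := forall s : G, S s -> S s^-1%g.

(* The elements of word length at most n; words use letters of S only, which
   is enough because S is always assumed to be symmetric. *)
Definition word_ball (n : nat) : set G :=
  [set x | exists w : seq G,
    [/\ {in w, forall s, S s}, (size w <= n)%N & x = (\prod_(s <- w) s)%g]].

Definition generating := \bigcup_n word_ball n = [set: G].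

(* word_ball n is finite whenever S is, so fset_set is not degenerate here. *)
Definition growth (A : set G) (n : nat) : nat :=
  #|` fset_set (A `&` word_ball n)|.

End WordMetric.

Definition centralizer (G : groupType) (g : G) : set G := [set x | commute x g].

Definition central (G : groupType) (g : G) := forall x : G, commute x g.

(* a A a^-1, whereas the library's x ^ a is a^-1 x a. *)
Definition conj_set (G : groupType) (a : G) (A : set G) : set G :=
  [set (a * x * a^-1)%g | x in A].

Section RegularRepresentation.
Variables (R : realType) (G : groupType).

Definition l2norm (xi : G -> R[i]) : \bar R :=
  sqrte (\esum_(x in [set: G]) (Normc.normc (xi x) ^+ 2)%:E).

Definition left_regular (y : G) (xi : G -> R[i]) : G -> R[i] :=
  fun x => xi (y^-1 * x)%g.

(* The group algebra is represented by {fsfun G -> R[i] with 0}, the functions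
   with finite support. *)
Definition lambda (f : {fsfun G -> R[i] with 0}) (xi : G -> R[i]) : G -> R[i] :=
  fun x => \sum_(y <- finsupp f) f y * left_regular y xi x.

Definition opnorm (f : {fsfun G -> R[i] with 0}) : \bar R :=
  ereal_sup [set l2norm (lambda f xi) | xi in [set xi | (l2norm xi <= 1)%E]].

(* The ratio is continuous and homogeneous of degree 0 on the finite-dimensional
   space of functions supported in the ball, so the supremum is a finite
   maximum. *)
Definition rho (S : set G) (n : nat) : \bar R :=
  ereal_sup [set (opnorm f / l2norm f)%E
    | f in [set f : {fsfun G -> R[i] with 0} |
             finsupp f != fset0 /\ [set` finsupp f] `<=` word_ball S n]].

End RegularRepresentation.

Section Subgroups.
Variable G : groupType.

(* Subsets of G are points of {ptws G -> bool}, i.e. {0,1}^G with the product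
   topology, and set_type carries the induced topology. *)
Definition subgroup_set : set {ptws G -> bool} :=
  [set H : {ptws G -> bool} | group_closed (H : {pred G})].

Definition Subgr : Type := set_type subgroup_set.

HB.instance Definition _ := Topological.copy Subgr (set_type subgroup_set).

Definition carrier (H : Subgr) : set G := [set x | set_val H x].

Lemma conj_subgroup_subproof (a : G) (H : Subgr) :
  subgroup_set (fun x : G => set_val H (a^-1 * x * a)%g).
Proof.
have [H1 HD] : subgroup_set (set_val H) by exact: set_mem (valP H).
split=> [|x y]; first by rewrite unfold_in /= mulg1 mulVg.
rewrite !unfold_in /= => Hx Hy; have := HD _ _ Hx Hy.
by rewrite unfold_in /= !invgM invgK !mulgA mulgK.
Qed.

(* The subgroup a H a^-1. *)
Definition conj_subgroup (a : G) (H : Subgr) : Subgr :=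
  SigSub (mem_set (conj_subgroup_subproof a H)).

Definition conj_invariant (K : set Subgr) :=
  forall (a : G) (H : Subgr), K H -> K (conj_subgroup a H).

Definition conj_minimal (K : set Subgr) :=
  forall L : set Subgr, L !=set0 -> closed L -> conj_invariant L ->
    L `<=` K -> L = K.

Definition URS (K : set Subgr) :=
  [/\ K !=set0, closed K, conj_invariant K & conj_minimal K].

(* Existence of a left-invariant finitely additive probability measure on all
   subsets of H; the values of m outside the subsets of H are irrelevant. *)
Definition amenable (R : realType) (H : Subgr) :=
  exists m : set G -> R,
    [/\ forall A, A `<=` carrier H -> 0 <= m A,
        m (carrier H) = 1,
        forall A B, A `<=` carrier H -> B `<=` carrier H -> A `&` B = set0 ->
          m (A `|` B) = m A + m B
      & forall h A, carrier H h -> A `<=` carrier H ->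
          m [set (h * x)%g | x in A] = m A].

Definition amenable_URS (R : realType) (K : set Subgr) :=
  URS K /\ forall H, K H -> amenable R H.

End Subgroups.

(* Main.v *)
Require Import Defs.
From HB Require Import structures.
From mathcomp Require Import all_boot all_order all_algebra finmap.
From mathcomp Require Import all_classical all_reals all_analysis.
From mathcomp Require Import complex zify ring lra.
Import Order.TTheory GRing.Theory Num.Theory.
Import numFieldNormedType.Exports.
Local Open Scope classical_set_scope.
Local Open Scope ring_scope.

Set Implicit Arguments.
Unset Strict Implicit.
Unset Printing Implicit Defensive.

(** Suppose that some member of the URS K contains g, and write C for the
    centralizer of g and C_n for its intersection with the ball of radius n.

    By minimality and compactness there are finitely many conjugators such that
    every member of K contains the corresponding conjugate of g for one of them
    ([URS_recurrence]).  Conjugating a member by elements of C does not change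
    whether it contains g, so one can choose H0 in K and a finite set T outside
    C such that, for every c in C, some c (t g t^-1) c^-1 with t in T lies in H0
    ([URS_recurrence_centralizer]).  By the pigeonhole principle, for each n
    there is t in T such that a fraction at least 1/|T| of the c in C_n
    conjugate q = t g t^-1 into H0.

    Let f be the sum of c q c^-1 over c in C_n, an element of the group algebra
    with nonnegative coefficients.  As H0 is amenable, the norm of lambda(f) is
    at least the total mass that f gives to H0, here |C_n|/|T|
    ([opnorm_ge_amenable_sum]).  On the other hand, two elements c, c' of C_n
    give the same conjugate of q only if c^-1 c' lies in C and in t C t^-1, and
    it has length at most 2n; so each coefficient of f is at most the growth M
    at 2n of the intersection of C and t C t^-1
    ([card_conj_fiber_centralizer_ball]), whence |f|_2^2 <= M |C_n|.  For n
    large f is supported in the ball of radius 3n, so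
    rho(3n)^2 M / |C_n| >= 1/|T|^2: the ratio of the hypothesis cannot tend to 0
    for all t in the finite set T.

    The lower bound on the norm uses Følner sets, whereas amenability is given
    as a finitely additive mean.  [amenable_folner] passes from one to the other
    combinatorially: without Følner sets a finite subset D of H0 satisfies
    |D F| >= 2 |F| for all finite F, the marriage theorem for infinite families
    ([hall_infinite]) then yields two injections of H0 into itself with disjoint
    images that are piecewise translations, and the mean would be at least 2. *)

(** * Hall's marriage theorem for infinite families of finite sets *)

Definition hall_condition (I X : choiceType) (A : I -> {fset X}) :=
  forall J : {fset I}, (#|` J| <= #|` (\bigcup_(i <- J) A i)%fset|)%N.

Definition remove_at (I X : choiceType) (A : I -> {fset X}) (i0 : I) (x : X) :
    I -> {fset X} :=
  fun i => if i == i0 then (A i `\ x)%fset else A i.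

Lemma remove_at_sub (I X : choiceType) (A : I -> {fset X}) i0 x i :
  (remove_at A i0 x i `<=` A i)%fset.
Proof. by rewrite /remove_at; case: eqP => // _; exact: fsubD1set. Qed.

Lemma hall_violation_remove_at (I X : choiceType) (A : I -> {fset X}) i0 x :
    hall_condition A -> ~ hall_condition (remove_at A i0 x) ->
  exists2 J : {fset I}, i0 \in J &
    (#|` (\bigcup_(i <- J) remove_at A i0 x i)%fset| < #|` J|)%N.
Proof.
move=> hA /existsNP[J /negP]; rewrite -ltnNge => hJ; exists J => //.
apply: contraLR hJ => i0J; rewrite -leqNgt; apply: leq_trans (hA J) _.
apply/fsubset_leq_card/bigfcupsP => i iJ _.
have -> : A i = remove_at A i0 x i.
  by rewrite /remove_at; case: eqP iJ => // ->; rewrite (negPf i0J).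
exact: bigfcup_sup.
Qed.

(** If both removals violated the condition, on J1 and on J2, the two unions
    would cover together the union of A over J1 `|` J2, and would meet in at
    least its union over J1 `&` J2 without i0; counting both gives one element
    too many. *)
Lemma hall_remove (I X : choiceType) (A : I -> {fset X}) i0 x y :
    hall_condition A -> x != y ->
  hall_condition (remove_at A i0 x) \/ hall_condition (remove_at A i0 y).
Proof.
move=> hA xy; apply: contrapT => /not_orP[hx hy].
have [J1 i0J1 hJ1] := hall_violation_remove_at hA hx.
have [J2 i0J2 hJ2] := hall_violation_remove_at hA hy.
set X1 := (\bigcup_(i <- J1) _)%fset in hJ1.
set X2 := (\bigcup_(i <- J2) _)%fset in hJ2.
have sub1 i z : i \in J1 -> z \in remove_at A i0 x i -> z \in X1.
  by move=> iJ ?; apply/bigfcupP; exists i; rewrite ?iJ.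
have sub2 i z : i \in J2 -> z \in remove_at A i0 y i -> z \in X2.
  by move=> iJ ?; apply/bigfcupP; exists i; rewrite ?iJ.
have hU : (#|` (J1 `|` J2)%fset| <= #|` (X1 `|` X2)%fset|)%N.
  apply: leq_trans (hA _) _; apply/fsubset_leq_card/bigfcupsP => i iJ _.
  apply/fsubsetP => z zA; rewrite inE.
  have [ii0|ii0] := eqVneq i i0; last first.
    have zr t : z \in remove_at A i0 t i by rewrite /remove_at (negPf ii0).
    by move: iJ; rewrite inE => /orP[] iJ;
      [rewrite (sub1 i)|rewrite (sub2 i) ?orbT].
  subst i; have [zx|zx] := eqVneq z x.
    by rewrite (sub2 i0) ?orbT// /remove_at eqxx !inE zx xy -zx.
  by rewrite (sub1 i0)// /remove_at eqxx !inE zx.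
have hI : (#|` ((J1 `&` J2) `\ i0)%fset| <= #|` (X1 `&` X2)%fset|)%N.
  apply: leq_trans (hA _) _; apply/fsubset_leq_card/bigfcupsP => i.
  rewrite !inE => /and3P[ii0 i1 i2] _; apply/fsubsetP => z zA.
  by rewrite inE (sub1 i)// ?(sub2 i)// /remove_at (negPf ii0).
have := cardfsUI J1 J2; have := cardfsUI X1 X2.
have := cardfsD1 i0 (J1 `&` J2)%fset; rewrite !inE i0J1 i0J2 /=.
move: hJ1 hJ2 hU hI; rewrite -/X1 -/X2; lia.
Qed.

Lemma chain_finite_upper_bound (T : Type) (I : eqType)
    (le : T -> T -> Prop) (C : set T) (c : I -> T) (s : seq I) :
    (forall x, le x x) -> (forall x y z, le x y -> le y z -> le x z) ->
    total_on C le -> C !=set0 -> (forall i, C (c i)) ->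
  exists2 u, C u & {in s, forall i, le (c i) u}.
Proof.
move=> le_refl le_trans Ctot [c0 Cc0] Cc; elim: s => [|i s [u Cu hu]].
  by exists c0.
have [iu|ui] := Ctot _ _ (Cc i) Cu.
- by exists u => // j; rewrite inE => /predU1P[->//|/hu].
- exists (c i) => // j; rewrite inE => /predU1P[->//|/hu ju].
  exact: le_trans ju ui.
Qed.

(** Rado's argument: among the subfamilies that still satisfy the condition, a
    minimal one, which Zorn's lemma provides because all sets are finite, has
    only singletons as members, since [hall_remove] would shrink any larger
    one. *)
Theorem hall_infinite (I X : choiceType) (A : I -> {fset X}) :
    hall_condition A ->
  exists2 phi : I -> X, injective phi & forall i, phi i \in A i.
Proof.
move=> hA.
pose T := {B : I -> {fset X} |
             hall_condition B /\ forall i, (B i `<=` A i)%fset}.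
pose le : rel T := fun B B' => `[< forall i, (sval B' i `<=` sval B i)%fset >].
have le_refl B : le B B by apply/asboolP.
have le_trans B1 B2 B3 : le B1 B2 -> le B2 B3 -> le B1 B3.
  move=> /asboolP h12 /asboolP h23; apply/asboolP => i.
  exact: fsubset_trans (h23 i) (h12 i).
have [|C Ctot|[B [hB BA]] Bmax] := Zorn le_refl le_trans.
- move=> [B hB] [B' hB'] /asboolP/= h /asboolP/= h'; apply/eq_exist.
  by apply/funext => i; apply/eqP; rewrite eqEfsubset h h'.
- have [->|C0] := eqVneq C set0.
    by exists (exist _ A (conj hA (fun=> fsubset_refl _))).
  have {}C0 : C !=set0 by exact/set0P.
  (* The bound takes at each i the smallest value that the chain takes there. *)
  have minC (i : I) : exists t : T, C t /\
      forall t', C t' -> (#|` sval t i| <= #|` sval t' i|)%N.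
    pose P n := `[< exists t, C t /\ #|` sval t i|%fset = n >].
    have exP : exists n, P n.
      by case: C0 => t Ct; exists #|` sval t i|; apply/asboolP; exists t.
    case: (ex_minnP exP) => n /asboolP[t [Ct tn]] nmin.
    exists t; split => // t' Ct'; rewrite tn; apply: nmin.
    by apply/asboolP; exists t'.
  have [c hc] := choice minC.
  have cmin i t : C t -> (sval (c i) i `<=` sval t i)%fset.
    move=> Ct; have [/asboolP//|/asboolP h] := Ctot _ _ Ct (hc i).1.
    suff /eqP -> : sval t i == sval (c i) i by exact: fsubset_refl.
    by rewrite eqEfcard h (hc i).2.
  have hB : hall_condition (fun i => sval (c i) i).
    move=> J.
    have [u Cu hu] := chain_finite_upper_bound J le_refl le_trans Ctot C0
                        (fun i => (hc i).1).
    apply: leq_trans ((svalP u).1 J) _; apply/fsubset_leq_card/bigfcupsP.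
    move=> i iJ _; apply: fsubset_trans (bigfcup_sup _ iJ isT).
    by have /asboolP := hu i iJ; apply.
  have BA i : (sval (c i) i `<=` A i)%fset by exact: (svalP (c i)).2.
  exists (exist _ (fun i => sval (c i) i) (conj hB BA)) => t Ct.
  by apply/asboolP => i; exact: cmin.
have B0 i : exists x, x \in B i.
  have := hB [fset i]%fset; rewrite cardfs1 big_seq_fset1 cardfs_gt0.
  by move=> /fset0Pn.
(* By maximality no element can be removed, so each B i is a singleton. *)
have B1 i x y : x \in B i -> y \in B i -> x = y.
  move=> xB yB; apply/eqP/negPn/negP => xy.
  have rm z : z \in B i -> ~ hall_condition (remove_at B i z).
    move=> zB hz.
    have zA j : (remove_at B i z j `<=` A j)%fset.
      exact: fsubset_trans (remove_at_sub _ _ _ _) (BA j).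
    have := Bmax (exist _ (remove_at B i z) (conj hz zA)).
    have /asboolP le_z : forall j, (remove_at B i z j `<=` B j)%fset.
      exact: remove_at_sub.
    move=> /(_ le_z)/(congr1 (fun f => sval f i)) /= e.
    by move: zB; rewrite -e /remove_at eqxx !inE eqxx.
  by case: (hall_remove i hB xy); exact: rm.
have [phi hphi] := choice B0.
exists phi => [i j eij|i]; last exact/(fsubsetP (BA i))/hphi.
apply/eqP/negPn/negP => ij.
have := hB [fset i; j]%fset; rewrite cardfs2 ij.
have sub : (\bigcup_(k <- [fset i; j]) B k `<=` [fset phi i])%fset.
  apply/bigfcupsP => k; rewrite !inE => /orP[]/eqP -> _; apply/fsubsetP => x.
    by rewrite inE => /B1/(_ (hphi i)) ->.
  by rewrite inE eij => /B1/(_ (hphi j)) ->.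
by move=> /leq_trans/(_ (fsubset_leq_card sub)); rewrite cardfs1.
Qed.

(** * Amenable subgroups admit Følner sets *)

Section SubgroupCarrier.
Variables (G : groupType) (H : Subgr G).

Let closedH : group_closed (set_val H : {pred G}).
Proof. exact: set_mem (valP H). Qed.

Lemma carrier1 : carrier H 1%g. Proof. exact: closedH.1. Qed.

Lemma carrierV x : carrier H x -> carrier H x^-1%g.
Proof. by move=> Hx; have := closedH.2 _ _ carrier1 Hx; rewrite div1g. Qed.

Lemma carrierM x y : carrier H x -> carrier H y -> carrier H (x * y)%g.
Proof.
by move=> Hx Hy; have := closedH.2 _ _ Hx (carrierV Hy); rewrite invgK.
Qed.

End SubgroupCarrier.

Section PiecewiseTranslation.
Variables (R : realType) (G : groupType) (H : Subgr G) (m : set G -> R).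
Hypotheses
  (mU : forall A B, A `<=` carrier H -> B `<=` carrier H -> A `&` B = set0 ->
     m (A `|` B) = m A + m B)
  (mM : forall h A, carrier H h -> A `<=` carrier H ->
     m [set (h * x)%g | x in A] = m A).

Lemma piecewise_translation_sub (phi : G -> G) (s : seq G) (A : set G) :
    {in s, forall d, carrier H d} -> A `<=` carrier H ->
    (forall x, A x -> exists2 d, d \in s & phi x = (d * x)%g) ->
  phi @` A `<=` carrier H.
Proof.
move=> sH AH phiA _ [x Ax <-]; have [d ds ->] := phiA x Ax.
by apply: carrierM; [exact: sH|exact: AH].
Qed.

Lemma mean_piecewise_translation (phi : G -> G) (s : seq G) (A : set G) :
    {in s, forall d, carrier H d} -> A `<=` carrier H -> injective phi ->
    (forall x, A x -> exists2 d, d \in s & phi x = (d * x)%g) ->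
  m (phi @` A) = m A.
Proof.
move=> sH AH phi_inj; elim: s A sH AH => [|d s IHs] A sH AH phiA.
  suff -> : A = set0 by rewrite image_set0.
  by apply/seteqP; split => // x /phiA[].
pose P := [set x | phi x = (d * x)%g].
have AP : A = (A `&` P) `|` (A `&` ~` P) by rewrite -setIUr setUv setIT.
have AI0 : (A `&` P) `&` (A `&` ~` P) = set0.
  by rewrite setIACA setICr setI0.
have sub1 : A `&` P `<=` carrier H by move=> x [/AH].
have sub2 : A `&` ~` P `<=` carrier H by move=> x [/AH].
have Hd : carrier H d by apply: sH; rewrite mem_head.
have sH' : {in s, forall d', carrier H d'}.
  by move=> d' ?; apply: sH; rewrite inE; apply/orP; right.
have phiA2 x : (A `&` ~` P) x -> exists2 d', d' \in s & phi x = (d' * x)%g.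
  move=> [/phiA[d' + phix] nPx]; rewrite inE => /predU1P[d'd|ds].
    by exfalso; apply: nPx; rewrite /P /= phix d'd.
  by exists d'.
have phi1 : phi @` (A `&` P) = [set (d * x)%g | x in A `&` P].
  by apply/seteqP; split => _ [x [Ax Px] <-]; exists x; rewrite ?Px.
rewrite [in RHS]AP mU// -(IHs _ sH' sub2 phiA2) -(mM Hd sub1) -phi1.
rewrite [in LHS]AP image_setU mU//.
- by apply: piecewise_translation_sub sH sub1 _ => // x [+ _]; exact: phiA.
- exact: piecewise_translation_sub sH' sub2 phiA2.
- apply/seteqP; split => // _ [[x Ax <-] [y Ay /phi_inj yx]].
  by move: Ay; rewrite yx => Ax'; move: AI0 => /seteqP[/(_ x (conj Ax Ax'))].
Qed.

End PiecewiseTranslation.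

(** Two injections that move each point of H by one of finitely many elements
    of H, and have disjoint images, would double the mean of H. *)
Lemma amenable_not_paradoxical (R : realType) (G : groupType) (H : Subgr G)
    (s : seq G) (phi : G * bool -> G) :
    amenable R H -> {in s, forall d, carrier H d} ->
    (forall p, exists2 d, d \in s & phi p = (d * p.1)%g) ->
  ~ injective phi.
Proof.
move=> [m [m_ge0 m1 mU mM]] sH phis phi_inj.
pose I b := (fun x => phi (x, b)) @` carrier H.
have Ib_inj b : injective (fun x => phi (x, b)) by move=> x y /phi_inj[].
have phisb b x : carrier H x -> exists2 d, d \in s & phi (x, b) = (d * x)%g.
  by move=> _; exact: phis (x, b).
have IH b : I b `<=` carrier H.
  exact: piecewise_translation_sub sH (@subset_refl _ _) (phisb b).
have mI b : m (I b) = 1.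
  rewrite -m1.
  exact: (mean_piecewise_translation mU mM sH (@subset_refl _ _) (@Ib_inj b)
            (phisb b)).
have I0 : I true `&` I false = set0.
  by apply/seteqP; split => // _ [[x _ <-] [y _ /phi_inj[]]].
have IU : I true `|` I false `<=` carrier H by move=> x [] /IH.
have : m (carrier H) = m (I true `|` I false)
    + m (carrier H `\` (I true `|` I false)).
  rewrite -mU ?setDUK// ?setDIK//; exact: subDsetl.
have : 0 <= m (carrier H `\` (I true `|` I false)).
  by apply: m_ge0; exact: subDsetl.
rewrite mU// m1 !mI; lra.
Qed.

Section FolnerSets.
Variable G : groupType.
Implicit Types (D E F : {fset G}) (h x : G).

Definition ltranslate h F : {fset G} := [fset (h * x)%g | x in F]%fset.

Definition fset_mul D F : {fset G} := (\bigcup_(d <- D) ltranslate d F)%fset.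

Lemma ltranslateP h F x : (x \in ltranslate h F) = ((h^-1 * x)%g \in F).
Proof.
apply/imfsetP/idP => /= [[y yF ->]|xF]; first by rewrite mulKg.
by exists (h^-1 * x)%g; rewrite // mulVKg.
Qed.

Lemma card_ltranslate h F : #|` ltranslate h F| = #|` F|.
Proof. by rewrite card_imfset//; exact: mulgI. Qed.

Lemma fset_mulP D F x :
  reflect (exists2 d, d \in D & (d^-1 * x)%g \in F) (x \in fset_mul D F).
Proof.
apply: (iffP (bigfcupP _ _ _ _)) => [[d /andP[dD _]]|[d dD dx]].
  by rewrite ltranslateP; exists d.
by exists d; rewrite ?dD// ltranslateP.
Qed.

Lemma fset_mulA D E F : fset_mul D (fset_mul E F) = fset_mul (fset_mul D E) F.
Proof.
apply/fsetP => x; apply/fset_mulP/fset_mulP => [[d dD /fset_mulP[e eE xF]]|].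
  exists (d * e)%g; last by rewrite invgM -mulgA.
  by apply/fset_mulP; exists d; rewrite // mulKg.
move=> [de /fset_mulP[d dD eE] xF]; exists d => //.
by apply/fset_mulP; exists (d^-1 * de)%g; rewrite // invgM invgK -!mulgA mulVKg.
Qed.

Lemma fset_mul1 F : fset_mul [fset 1%g]%fset F = F.
Proof.
apply/fsetP => x; apply/fset_mulP/idP => [[d]|xF].
  by rewrite inE => /eqP ->; rewrite invg1 mul1g.
by exists 1%g; rewrite ?inE// invg1 mul1g.
Qed.

Definition fset_exp E (j : nat) := iter j (fset_mul E) [fset 1%g]%fset.

Lemma bernoulli_double k : (0 < k)%N -> (2 * k ^ k <= k.+1 ^ k)%N.
Proof.
move=> k0; rewrite -(leq_pmul2l k0) mulnA [(k * 2)%N]muln2 -addnn.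
suff h j : ((k + j) * k ^ j <= k * k.+1 ^ j)%N by exact: h.
elim: j => [|j IHj]; first by rewrite !expn0 addn0.
rewrite !expnS; have := leq_mul IHj (leqnn k.+1); nia.
Qed.

(** Without Følner sets each multiplication by E enlarges a finite set by the
    factor 1 + 1/k, and (1 + 1/k)^k >= 2. *)
Lemma no_folner_doubling E k : (0 < k)%N -> 1%g \in E ->
    (forall F, F != fset0 ->
       exists2 h, h \in E &
         (#|` F| < k * #|` (ltranslate h F `\` F)%fset|)%N) ->
  forall F, (2 * #|` F| <= #|` fset_mul (fset_exp E k) F|)%N.
Proof.
move=> k0 E1 noF F.
have step F' : (k.+1 * #|` F'| <= k * #|` fset_mul E F'|)%N.
  have [->|F'0] := eqVneq F' fset0; first by rewrite cardfs0 muln0.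
  have [h hE hF'] := noF _ F'0.
  have sub : (F' `|` (ltranslate h F' `\` F') `<=` fset_mul E F')%fset.
    apply/fsubsetP => x; rewrite !inE ltranslateP => /orP[xF'|/andP[_ xF']].
      by apply/fset_mulP; exists 1%g; rewrite // invg1 mul1g.
    by apply/fset_mulP; exists h.
  have := fsubset_leq_card sub.
  have := cardfsUI F' (ltranslate h F' `\` F')%fset.
  have -> : (F' `&` (ltranslate h F' `\` F') = fset0)%fset.
    by apply/fsetP => x; rewrite !inE; case: (x \in F').
  rewrite cardfs0 addn0 => ->; nia.
have iter_step j :
    (k.+1 ^ j * #|` F| <= k ^ j * #|` fset_mul (fset_exp E j) F|)%N.
  elim: j => [|j IHj]; first by rewrite !expn0 !mul1n fset_mul1.
  rewrite !expnS /fset_exp iterS -fset_mulA.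
  have := step (fset_mul (fset_exp E j) F).
  by move: IHj; rewrite /fset_exp; nia.
have := iter_step k; have := bernoulli_double k0.
have : (0 < k ^ k)%N by rewrite expn_gt0 k0.
nia.
Qed.

Lemma card_double_cover (T : choiceType) (J : {fset T * bool}) :
  (#|` J| <= 2 * #|` [fset p.1 | p in J]%fset|)%N.
Proof.
set F := [fset p.1 | p in J]%fset.
pose copy (b : bool) := [fset (x, b) | x in F]%fset.
have card_copy b : #|` copy b| = #|` F| by rewrite card_imfset// => x y [].
have sub : (J `<=` copy true `|` copy false)%fset.
  apply/fsubsetP => -[x b] xJ; rewrite inE.
  have xF : x \in F by apply/imfsetP; exists (x, b).
  by case: b xJ => _; apply/orP; [left|right]; apply/imfsetP; exists x.
apply: leq_trans (fsubset_leq_card sub) _.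
by rewrite mul2n -addnn -[X in (_ <= X + _)%N](card_copy true)
  -[X in (_ <= _ + X)%N](card_copy false) -cardfsUI leq_addr.
Qed.

(** The Følner sets are subsets of G, not of H: this is all that is needed for
    almost invariant vectors of the regular representation of G.  If there were
    none, the doubling property would be Hall's condition for choosing, for
    each x of G, two points of D x, with D a finite subset of H. *)
Theorem amenable_folner (R : realType) (H : Subgr G) E k :
    amenable R H -> {in E, forall h, carrier H h} -> (0 < k)%N ->
  exists2 F, F != fset0 &
    {in E, forall h, (k * #|` (ltranslate h F `\` F)%fset| <= #|` F|)%N}.
Proof.
move=> amenH EH k0; apply: contrapT => noF.
pose E1 := (1%g |` E)%fset; pose D := fset_exp E1 k.
have doubling : forall F, (2 * #|` F| <= #|` fset_mul D F|)%N.
  apply: no_folner_doubling => //; first by rewrite !inE eqxx.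
  move=> F F0; apply: contrapT => hF; apply: noF; exists F => // h hE.
  rewrite leqNgt; apply/negP => hlt; apply: hF; exists h => //.
  by rewrite !inE hE orbT.
have DH : {in D, forall d, carrier H d}.
  rewrite /D; elim: (k) => [|j IHj] d.
    by rewrite inE => /eqP ->; exact: carrier1.
  rewrite /fset_exp iterS => /fset_mulP[e + /IHj ed].
  rewrite !inE => eE; rewrite -(mulVKg e d); apply: carrierM => //.
  by case/predU1P: eE => [->|/EH//]; exact: carrier1.
pose A (p : G * bool) := fset_mul D [fset p.1]%fset.
have hall_A : hall_condition A.
  move=> J; apply: leq_trans (card_double_cover J) _.
  apply: leq_trans (doubling _) _; apply/fsubset_leq_card/fsubsetP => x.
  move=> /fset_mulP[d dD /imfsetP[/= p pJ dx]]; apply/bigfcupP; exists p.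
    by rewrite pJ.
  by apply/fset_mulP; exists d; rewrite // dx inE.
have [phi phi_inj phiA] := hall_infinite hall_A.
apply: (amenable_not_paradoxical amenH DH) phi_inj => p.
have /fset_mulP[d dD] := phiA p; rewrite inE => /eqP dp.
by exists d; rewrite // -dp mulVKg.
Qed.

End FolnerSets.

(** * Norms of group algebra elements with nonnegative coefficients *)

Section Norms.
Variables (R : realType) (G : groupType).
Implicit Types (xi : G -> R[i]) (f : {fsfun G -> R[i] with 0}).

Lemma normc_real (r : R) : Normc.normc r%:C%C = `|r|.
Proof. by rewrite /Normc.normc /= expr0n /= addr0 sqrtr_sqr. Qed.

Lemma fsbig_fset (T : choiceType) (F : {fset T}) (u : T -> R) :
  (\sum_(x \in [set` F]) (u x)%:E = (\sum_(x <- F) u x)%:E)%E.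
Proof. by rewrite fsbig_finite// set_fsetK sumEFin. Qed.

Lemma l2norm_ge_fset xi (F : {fset G}) :
  (sqrte (\sum_(x <- F) Normc.normc (xi x) ^+ 2)%:E <= l2norm xi)%E.
Proof.
have ge0 : (0 <= \esum_(x in [set: G]) (Normc.normc (xi x) ^+ 2)%:E)%E.
  by apply: esum_ge0 => x _; rewrite lee_fin sqr_ge0.
rewrite /l2norm lee_sqrt//; apply: esum_ge.
by exists [set` F]; rewrite ?fsbig_fset//; split.
Qed.

Lemma l2norm_fset xi (F : {fset G}) : (forall x, x \notin F -> xi x = 0) ->
  (l2norm xi = sqrte (\sum_(x <- F) Normc.normc (xi x) ^+ 2)%:E)%E.
Proof.
move=> xi0; rewrite /l2norm -fsbig_fset -esum_fset//; last first.
  by move=> x _; rewrite lee_fin sqr_ge0.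
rewrite [in RHS]esum_mkcond; congr sqrte; apply: eq_esum => x _.
case: ifPn => //; rewrite notin_setE /= => /negP/xi0 ->.
by rewrite Normc.normc0 expr0n.
Qed.

Lemma opnorm_ge f xi : (l2norm xi <= 1 -> l2norm (lambda f xi) <= opnorm f)%E.
Proof. by move=> xi1; apply: ereal_sup_ubound; exists xi. Qed.

Lemma card_bigfcup_le (I T : choiceType) (r : seq I) (A : I -> {fset T}) k n :
    {in r, forall i, (k * #|` A i| <= n)%N} ->
  (k * #|` (\bigcup_(i <- r) A i)%fset| <= size r * n)%N.
Proof.
elim: r => [|i r IHr] Ar; first by rewrite big_nil cardfs0 muln0.
rewrite big_cons mulSn.
apply: leq_trans (leq_mul (leqnn k) (leq_card_fsetU _ _).1) _.
rewrite mulnDr leq_add//; first by apply: Ar; exact: mem_head.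
by apply: IHr => j jr; apply: Ar; rewrite inE jr orbT.
Qed.

(** Normalized indicator functions of Følner sets are almost fixed by the
    elements of H, and dropping the coefficients outside H only lowers a sum of
    nonnegative terms. *)
Theorem opnorm_ge_amenable_sum f (c : G -> R) (H : Subgr G) :
    (forall y, f y = (c y)%:C%C) -> (forall y, 0 <= c y) -> amenable R H ->
  ((\sum_(y <- finsupp f | y \in carrier H) c y)%:E <= opnorm f)%E.
Proof.
move=> fc c_ge0 amenH; set s := (X in X%:E).
have s_ge0 : 0 <= s by exact: sumr_ge0.
apply/lee_mul01Pr => [|r /andP[r0 r1]]; first by rewrite lee_fin.
pose E := [fset y in finsupp f | y \in carrier H]%fset.
have EH : {in E, forall h, carrier H h}.
  by move=> h; rewrite !inE => /andP[_ /set_mem].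
have [k k0 hk] : exists2 k, (0 < k)%N & #|` E|%:R <= (1 - r ^+ 2) * k%:R.
  have e0 : 0 < 1 - r ^+ 2 by rewrite subr_gt0 expr_lt1// ltW.
  exists (Num.truncn (#|` E|%:R / (1 - r ^+ 2))).+1 => //.
  by rewrite mulrC -ler_pdivrMr//; apply/ltW/truncnS_gt.
have [F F0 folF] := amenable_folner amenH EH k0.
have cF0 : 0 < #|` F|%:R :> R by rewrite ltr0n cardfs_gt0.
pose v : R := (Num.sqrt #|` F|%:R)^-1.
have v_ge0 : 0 <= v by rewrite invr_ge0 sqrtr_ge0.
have v2 : v ^+ 2 = #|` F|%:R^-1 by rewrite exprVn sqr_sqrtr// ltW.
pose t x : R := if x \in F then v else 0.
have t_ge0 x : 0 <= t x by rewrite /t; case: ifP.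
pose xi x : R[i] := (t x)%:C%C.
have xi1 : (l2norm xi <= 1)%E.
  rewrite (@l2norm_fset _ F); last by move=> x /negPf xF; rewrite /xi /t xF.
  rewrite big_seq (eq_bigr (fun=> v ^+ 2)) => [|x xF]; last first.
    by rewrite normc_real ger0_norm// /t xF.
  rewrite -big_seq big_const_seq count_predT iter_addr_0 v2.
  rewrite -[_^-1 *+ _]mulr_natr mulVf//.
    by rewrite /= sqrtr1.
  by rewrite gt_eqF.
apply: le_trans (opnorm_ge f xi1).
pose F' := [fset x in F | [forall y : E, (val y)^-1 * x \in F]%g]%fset.
have lam x : x \in F' -> s * v <= Normc.normc (lambda f xi x).
  rewrite !inE => /andP[xF /forallP xE].
  have -> : lambda f xi x = (\sum_(y <- finsupp f) c y * t (y^-1 * x)%g)%:C%C.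
    rewrite /lambda rmorph_sum; apply: eq_bigr => y _.
    by rewrite fc /left_regular /xi rmorphM.
  rewrite normc_real ger0_norm; last by apply: sumr_ge0 => y _; exact: mulr_ge0.
  rewrite mulr_suml [leLHS]big_mkcond [leLHS]big_seq [leRHS]big_seq.
  apply: ler_sum => y yf; case: ifPn => yH; last exact: mulr_ge0.
  have yE : y \in E by rewrite !inE yf yH.
  by have /= := xE [` yE]%fset; rewrite /t => ->.
have cF' : r ^+ 2 * #|` F|%:R <= #|` F'|%:R.
  have sub : (F `\` F' `<=` \bigcup_(y <- E) (F `\` ltranslate y F)%fset)%fset.
    apply/fsubsetP => x; rewrite !inE => /andP[+ xF]; rewrite xF /=.
    move=> /forallPn[/= y xy]; apply/bigfcupP.
    exists (val y); first by rewrite (valP y).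
    by rewrite inE xF ltranslateP andbT.
  have cE : (k * #|` (F `\` F')%fset| <= #|` E| * #|` F|)%N.
    apply: leq_trans (leq_mul (leqnn k) (fsubset_leq_card sub)) _.
    apply: card_bigfcup_le => y /folF.
    by rewrite !cardfsD card_ltranslate fsetIC.
  have F'F : (F' `<=` F)%fset by apply/fsubsetP => x; rewrite !inE => /andP[].
  have cFF' := fsubset_leq_card F'F.
  have k0' : 0 < k%:R :> R by rewrite ltr0n.
  rewrite -(ler_pM2l k0') -[#|` F'|](subKn cFF') -cardfsDS// natrB; last first.
    by rewrite cardfsDS// leq_subr.
  rewrite mulrBr lerBrDr.
  have : k%:R * #|` (F `\` F')%fset|%:R <= #|` E|%:R * #|` F|%:R :> R.
    by rewrite -!natrM ler_nat.
  have : #|` E|%:R * #|` F|%:R <= (1 - r ^+ 2) * k%:R * #|` F|%:R.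
    by rewrite ler_pM2r.
  by move: (_%:R) => ?; lra.
apply: le_trans (l2norm_ge_fset _ F').
rewrite -EFinM /= lee_fin.
rewrite -[leLHS]ger0_norm; last by rewrite mulr_ge0// ltW.
rewrite -sqrtr_sqr ler_wsqrtr//.
apply: (@le_trans _ _ (\sum_(x <- F') (s * v) ^+ 2)); last first.
  rewrite big_seq [leRHS]big_seq; apply: ler_sum => x /lam.
  by move=> h; rewrite lerXn2r// ?nnegrE ?mulr_ge0// (le_trans _ h)// mulr_ge0.
rewrite big_const_seq count_predT iter_addr_0 !exprMn v2 -[_ *+ _]mulr_natr.
rewrite [leLHS]mulrC -[leRHS]mulrA ler_wpM2l ?sqr_ge0//.
by rewrite ler_pdivlMl// mulrC.
Qed.

End Norms.

(** * The space of subgroups *)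

(* Any base point serves: compact_cover needs a pointed space. *)
HB.instance Definition _ (T : Type) :=
  isPointed.Build {ptws T -> bool} (fun=> false).

Section SubgroupSpace.
Variable G : groupType.

Lemma eval_continuous (x : G) : continuous (fun H : {ptws G -> bool} => H x).
Proof. exact: (@proj_continuous G (fun=> bool) x). Qed.

Lemma closed_eval_true (x : G) : closed [set H : {ptws G -> bool} | H x].
Proof.
exact: (closed_comp (fun H _ => @eval_continuous x H)
  (discrete_closed [set b : bool | b])).
Qed.

Lemma open_eval_true (x : G) : open [set H : {ptws G -> bool} | H x].
Proof.
exact: (open_comp (fun H _ => @eval_continuous x H)
  (discrete_open [set b : bool | b])).
Qed.

Lemma closed_subgroup_set : closed (@subgroup_set G).
Proof.
have -> : @subgroup_set G = [set H : {ptws G -> bool} | H 1%g] `&`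
    \bigcap_(p : G * G) (~` [set H : {ptws G -> bool} | H p.1] `|`
      ~` [set H : {ptws G -> bool} | H p.2] `|`
      [set H : {ptws G -> bool} | H (p.1 / p.2)%g]).
  apply/seteqP; split => H.
    move=> [H1 HV]; split => //= -[x y] _ /=.
    have [Hx|/negP] := boolP (H x); last by left; left.
    have [Hy|/negP] := boolP (H y); last by left; right.
    by right; exact: HV.
  move=> [H1 HV]; split => // x y Hx Hy.
  by have [[/(_ Hx)|/(_ Hy)]|] := HV (x, y) I.
apply: closedI; first exact: closed_eval_true.
apply: closed_bigI => p _; apply: closedU; last exact: closed_eval_true.
by apply: closedU; apply: open_closedC; exact: open_eval_true.
Qed.

Lemma compact_image_set_val (K : set (Subgr G)) :
  closed K -> compact (set_val @` K : set {ptws G -> bool}).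
Proof.
move=> /closed_openC[U Uo UK].
have -> : set_val @` K = @subgroup_set G `&` ~` U.
  apply/seteqP; split => [_ [H KH <-]|H [SH UH]].
    split; first exact: set_mem (valP H).
    by move=> UH; have : (~` K) H by rewrite -UK.
  exists (SigSub (mem_set SH)) => //; apply: contrapT => nK.
  by apply: UH; move: nK; rewrite -[~ _]/((~` K) _) -UK.
have compactT : compact [set: {ptws G -> bool}].
  have := @tychonoff G (fun=> bool) (fun=> setT) (fun=> bool_compact).
  by congr (compact _); apply/seteqP; split.
apply: subclosed_compact compactT (@subsetT _ _).
by apply: closedI; [exact: closed_subgroup_set|exact: open_closedC].
Qed.

Lemma open_mem (x : G) : open [set H : Subgr G | carrier H x].
Proof.
by exists [set H : {ptws G -> bool} | H x] => //; exact: open_eval_true.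
Qed.

Lemma closed_notin (x : G) : closed [set H : Subgr G | ~ carrier H x].
Proof. by apply: open_closedC; exact: open_mem. Qed.

Lemma conj_subgroupP (a x : G) (H : Subgr G) :
  carrier (conj_subgroup a H) x = carrier H (a^-1 * x * a)%g.
Proof. by []. Qed.

(** By minimality no member of the URS avoids all conjugates of an element that
    some member contains; finitely many conjugates suffice by compactness. *)
Lemma URS_recurrence (K : set (Subgr G)) (H1 : Subgr G) (g : G) :
    URS K -> K H1 -> carrier H1 g ->
  exists T : {fset G}, forall H, K H ->
    exists2 t, t \in T & carrier H (t * g * t^-1)%g.
Proof.
move=> [K0 Kcl Kinv Kmin] KH1 H1g.
pose L := K `&` \bigcap_(a in [set: G])
  [set H : Subgr G | ~ carrier H (a * g * a^-1)%g].
have Lcl : closed L.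
  by apply: closedI => //; apply: closed_bigI => a _; exact: closed_notin.
have Linv : conj_invariant L.
  move=> b H [KH LH]; split; first exact: Kinv.
  move=> a _ /=; rewrite conj_subgroupP => Hx; apply: (LH (b^-1 * a)%g) => //=.
  by rewrite invgM invgK !mulgA in Hx *.
have L0 : ~ (L !=set0).
  move=> L0; move: KH1; rewrite -(Kmin L L0 Lcl Linv (@subIsetl _ _ _)) => -[_].
  by move=> /(_ 1%g Logic.I); apply; rewrite mul1g invg1 mulg1.
move: (compact_image_set_val Kcl); rewrite compact_cover.
move=> /(_ G setT (fun t => [set H : {ptws G -> bool} | H (t * g * t^-1)%g])).
case=> [t _|_ [H KH <-]|T _ Tcov].
- exact: open_eval_true.
- apply: contrapT => nH; apply: L0; exists H; split => // a _ /= Ha.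
  by apply: nH; exists a.
- exists T => H KH; have [t tT Ht] := Tcov _ (imageP _ KH).
  by exists t.
Qed.

(** If g belongs to every member of the URS, any conjugator outside the
    centralizer works.  Otherwise take H0 without g: its conjugates under the
    centralizer do not contain g either, so the conjugators that recurrence
    gives for them lie outside the centralizer. *)
Lemma URS_recurrence_centralizer (K : set (Subgr G)) (H1 : Subgr G) (g : G) :
    URS K -> K H1 -> carrier H1 g -> ~ central g ->
  exists (H0 : Subgr G) (T : {fset G}), [/\ K H0,
    {in T, forall t, ~ centralizer g t} &
    forall c, centralizer g c ->
      exists2 t, t \in T & carrier H0 (c * (t * g * t^-1) * c^-1)%g].
Proof.
move=> uK KH1 H1g /existsNP[a ga].
have [_ _ Kinv _] := uK.
have [allK|] := pselect (forall H, K H -> carrier H g).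
  exists H1, [fset a]%fset; split => // [t|c _].
    by rewrite inE => /eqP ->.
  exists a; first by rewrite inE.
  have := allK _ (Kinv (c * a)^-1%g _ KH1).
  by rewrite conj_subgroupP invgK invgM !mulgA.
move=> /existsNP[H0 /not_implyP[KH0 H0g]].
have [T hT] := URS_recurrence uK KH1 H1g.
exists H0, [fset t in T | t \in ~` centralizer g]%fset; split => // [t|c cg].
  by rewrite !inE => /andP[_ /set_mem].
have [t tT] := hT _ (Kinv c^-1%g _ KH0).
rewrite conj_subgroupP invgK => Ht; exists t => //.
rewrite !inE tT /=; apply/mem_set => tg; apply: H0g.
move: Ht; rewrite tg mulgK; rewrite (_ : (c * g * c^-1 = g)%g)//.
by rewrite cg mulgK.
Qed.

End SubgroupSpace.

(** * Balls, conjugates and the rapid decay function *)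

Section WordBalls.
Variables (G : groupType) (S : set G).

Lemma word_ball1 n : word_ball S n 1%g.
Proof. by exists [::]; split; rewrite ?big_nil. Qed.

Lemma word_ballM m n x y :
  word_ball S m x -> word_ball S n y -> word_ball S (m + n) (x * y)%g.
Proof.
move=> [v [vS sv ->]] [w [wS sw ->]]; exists (v ++ w); split.
- by move=> s; rewrite mem_cat => /orP[/vS|/wS].
- by rewrite size_cat leq_add.
- by rewrite big_cat.
Qed.

Lemma word_ball_le m n x : (m <= n)%N -> word_ball S m x -> word_ball S n x.
Proof.
by move=> mn [w [wS sw ->]]; exists w; split => //; exact: leq_trans mn.
Qed.

Lemma word_ballV n x :
  symmetric_set S -> word_ball S n x -> word_ball S n x^-1%g.
Proof.
move=> symS [w [wS sw ->]]; exists (rev [seq s^-1%g | s <- w]); split.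
- by move=> s; rewrite mem_rev => /mapP[t /wS St ->]; exact: symS.
- by rewrite size_rev size_map.
elim: w {wS sw} => [|s w IHw]; first by rewrite !big_nil invg1.
by rewrite big_cons invgM IHw /= rev_cons -cats1 big_cat /= big_seq1.
Qed.

Lemma finite_word_ball n : finite_set S -> finite_set (word_ball S n).
Proof.
move=> finS; elim: n => [|n IHn].
  apply: (sub_finite_set _ (finite_set1 (1%g : G))) => x [w [_ + ->]].
  by rewrite leqn0 size_eq0 => /eqP ->; rewrite big_nil.
have fin1 : finite_set ([set 1%g] `|`
    [set (s * x)%g | s in S & x in word_ball S n]).
  by rewrite finite_setU; split => //; exact: finite_image2.
apply: sub_finite_set fin1 => x [[|s w] [wS sw ->]].
  by left; rewrite big_nil.
right; exists s; first by apply: wS; rewrite mem_head.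
exists (\prod_(t <- w) t)%g; last by rewrite big_cons.
by exists w; split => // t tw; apply: wS; rewrite inE tw orbT.
Qed.

End WordBalls.

Section ConjugateSum.
Variables (R : realType) (G : groupType).
Implicit Types (F : {fset G}) (q : G).

Definition conjugates F q : {fset G} := [fset (a * q * a^-1)%g | a in F]%fset.

Definition conj_fiber F q x : {fset G} :=
  [fset a in F | (a * q * a^-1)%g == x]%fset.

Definition conj_sum F q : {fsfun G -> R[i] with 0} :=
  [fsfun x in conjugates F q => (#|` conj_fiber F q x|%:R : R)%:C%C | 0].

Lemma conj_sumE F q x : conj_sum F q x = (#|` conj_fiber F q x|%:R : R)%:C%C.
Proof.
rewrite fsfun_fun; case: ifPn => // xF.
suff -> : conj_fiber F q x = fset0 by rewrite cardfs0.
apply/fsetP => a; rewrite !inE; apply: contraNF xF => /andP[aF /eqP <-].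
by apply/imfsetP; exists a.
Qed.

Lemma finsupp_conj_sum F q : finsupp (conj_sum F q) = conjugates F q.
Proof.
apply/fsetP => x; rewrite mem_finsupp conj_sumE.
have -> : ((#|` conj_fiber F q x|%:R : R)%:C%C != 0) =
    (conj_fiber F q x != fset0).
  by rewrite (inj_eq (@complexI _) _ 0) pnatr_eq0 cardfs_eq0.
apply/fset0Pn/imfsetP => [[a]|[/= a aF ->]].
  by rewrite !inE => /andP[aF /eqP <-]; exists a.
by exists a; rewrite !inE aF eqxx.
Qed.

Lemma sum_card_conj_fiber F q (P : pred G) :
  (\sum_(x <- conjugates F q | P x) #|` conj_fiber F q x| =
   #|` [fset a in F | P (a * q * a^-1)%g]%fset|)%N.
Proof.
rewrite [RHS]card_fset_sum1 -big_fset_condE.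
rewrite [RHS]big_mkcond (partition_big_imfset _ (fun a => a * q * a^-1)%g) /=.
rewrite [LHS]big_mkcond; apply: eq_bigr => x _.
rewrite card_fset_sum1 -big_fset_condE; case: ifPn => Px.
  by apply: eq_bigr => a /eqP ->; rewrite Px.
by rewrite big1// => a /eqP ->; rewrite (negPf Px).
Qed.

Lemma l2norm_conj_sum_le F q M :
    (forall x, (#|` conj_fiber F q x| <= M)%N) ->
  (l2norm (conj_sum F q) <= (Num.sqrt (M * #|` F|)%:R)%:E)%E.
Proof.
move=> hM; rewrite (@l2norm_fset _ _ _ (conjugates F q)); last first.
  by move=> x; rewrite -finsupp_conj_sum memNfinsupp => /eqP.
rewrite /= lee_fin ler_wsqrtr//.
have -> : #|` F| = (\sum_(x <- conjugates F q) #|` conj_fiber F q x|)%N.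
  rewrite (sum_card_conj_fiber F q predT); congr #|` _|.
  by apply/fsetP => a; rewrite !inE andbT.
rewrite big_distrr /= natr_sum; apply: ler_sum => x _.
by rewrite conj_sumE normc_real normr_nat natrM expr2 ler_wpM2r// ler_nat.
Qed.

Lemma l2norm_conj_sum_gt0 F q : F != fset0 ->
  (0 < l2norm (conj_sum F q))%E.
Proof.
move=> /fset0Pn[a aF]; set x := (a * q * a^-1)%g.
apply: lt_le_trans (l2norm_ge_fset _ [fset x]%fset).
rewrite big_seq_fset1 /= lte_fin sqrtr_gt0 conj_sumE normc_real normr_nat.
rewrite exprn_gt0// ltr0n cardfs_gt0; apply/fset0Pn; exists a.
by rewrite !inE aF eqxx.
Qed.

(** Compare the norm of the sum of the conjugates, which is bounded below by
    the number of conjugates in H, with its l2-norm, which is small when few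
    elements of F give the same conjugate. *)
Lemma rho_ge_conj_sum (S : set G) (N M : nat) F q (H : Subgr G) :
    amenable R H -> F != fset0 -> (0 < M)%N ->
    [set` conjugates F q] `<=` word_ball S N ->
    (forall x, (#|` conj_fiber F q x| <= M)%N) ->
  ((#|` [fset a in F | (a * q * a^-1)%g \in carrier H]%fset|%:R
      / Num.sqrt (M * #|` F|)%:R)%:E <= rho R S N)%E.
Proof.
move=> amenH F0 M0 ball hM; set s := #|` _|.
pose f := conj_sum F q.
have f_rho : (opnorm f / l2norm f <= rho R S N)%E.
  apply: ereal_sup_ubound; exists f => //; split => /=; last first.
    by rewrite finsupp_conj_sum.
  rewrite finsupp_conj_sum; have [a aF] := fset0Pn _ F0.
  by apply/fset0Pn; exists (a * q * a^-1)%g; apply/imfsetP; exists a.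
apply: le_trans f_rho.
have s_le : (s%:R%:E <= opnorm f)%E.
  apply: le_trans (opnorm_ge_amenable_sum (conj_sumE F q) _ amenH) => //.
  rewrite finsupp_conj_sum -natr_sum lee_fin ler_nat.
  by rewrite (sum_card_conj_fiber F q (fun x => x \in carrier H)).
have := l2norm_conj_sum_le hM; have := l2norm_conj_sum_gt0 q F0.
rewrite -/f; case: (l2norm f) => // l; rewrite lte_fin lee_fin => l0 l_le.
rewrite inver gt_eqF// lee_pdivlMr// -EFinM; apply: le_trans s_le.
rewrite lee_fin mulrAC ler_pdivrMr ?(lt_le_trans l0)//.
by rewrite ler_wpM2l.
Qed.

End ConjugateSum.

(** * Conjugation by the centralizer *)

Section Centralizer.
Variables (G : groupType) (S : set G) (g : G).
Hypotheses (finS : finite_set S) (symS : symmetric_set S).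

Definition centralizer_ball n : {fset G} :=
  fset_set (centralizer g `&` word_ball S n).

Lemma in_centralizer_ball n a :
  reflect (commute a g /\ word_ball S n a) (a \in centralizer_ball n).
Proof.
rewrite in_fset_set; last exact: finite_setIr (finite_word_ball _ finS).
by apply: (iffP idP) => [/set_mem//|?]; exact/mem_set.
Qed.

Lemma centralizer_ball_neq0 n : centralizer_ball n != fset0.
Proof.
apply/fset0Pn; exists 1%g; apply/in_centralizer_ball; split.
  exact/commute_sym/commute1.
exact: word_ball1.
Qed.

(** Two elements a, a' of the centralizer C that conjugate q = t g t^-1 to the
    same element differ by a^-1 a', which is in C and commutes with q, that is,
    belongs to t C t^-1. *)
Lemma card_conj_fiber_centralizer_ball n t x :
  (#|` conj_fiber (centralizer_ball n) (t * g * t^-1)%g x|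
    <= growth S (centralizer g `&` conj_set t (centralizer g)) (2 * n))%N.
Proof.
set q := (t * g * t^-1)%g.
have [->|/fset0Pn[a0]] := eqVneq (conj_fiber (centralizer_ball n) q x) fset0.
  by rewrite cardfs0.
rewrite !inE => /andP[/in_centralizer_ball[a0g a0n] /eqP a0x].
rewrite -(card_ltranslate a0^-1); apply/fsubset_leq_card/fsubsetP => b.
rewrite ltranslateP invgK !inE.
move=> /andP[/in_centralizer_ball[a0bg a0bn] /eqP bx].
have bg : commute b g.
  rewrite -(mulKg a0 b); apply/commute_sym/commuteM; last exact: commute_sym.
  exact/commuteV/commute_sym.
have bq : commute b q.
  apply: (mulgI a0); apply: (mulIg (a0 * b)^-1%g).
  by rewrite mulgA bx -a0x invgM !mulgA mulgK.
rewrite in_fset_set; last exact: finite_setIr (finite_word_ball _ finS).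
apply/mem_set; split; last first.
  rewrite -(mulKg a0 b) mul2n -addnn; apply: word_ballM => //.
  exact: word_ballV.
split; first exact: bg.
exists (t^-1 * b * t)%g; last by rewrite !mulgA mulgV mul1g mulgK.
have := congr1 (fun y => t^-1 * y * t)%g bq.
by rewrite /q !mulgA mulgVK mulVg mul1g /centralizer /= /commute !mulgA.
Qed.

Lemma conjugates_centralizer_ball n L q : word_ball S L q ->
  [set` conjugates (centralizer_ball n) q] `<=` word_ball S (n + L + n).
Proof.
move=> qL _ /imfsetP[/= a /in_centralizer_ball[_ an] ->].
by apply: word_ballM; [exact: word_ballM|exact: word_ballV].
Qed.

End Centralizer.

Theorem corollary1 (R : realType) (G : groupType) (S : set G)
    (finS : finite_set S) (symS : symmetric_set S) (genS : generating S)
    (g : G) (g_noncentral : ~ central g)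
    (hlim : forall gamma : G, ~ centralizer g gamma ->
      (fun n : nat =>
        ((rho R S (3 * n)) ^+ 2
          * (growth S (centralizer g `&` conj_set gamma (centralizer g))
               (2 * n))%:R%:E
          / (growth S (centralizer g) n)%:R%:E)%E) @ \oo --> (0%E : \bar R))
    (K : set (Subgr G)) (hK : amenable_URS R K) :
  forall H : Subgr G, K H -> ~ carrier H g.
Proof.
move=> H1 KH1 H1g; have [uK amenK] := hK.
have [H0 [T [KH0 Tg hT]]] := URS_recurrence_centralizer uK KH1 H1g g_noncentral.
pose C := centralizer_ball S g; pose m := #|` T|.
have m0 : (0 < m)%N.
  have [|t tT _] := hT 1%g; first exact/commute_sym/commute1.
  by rewrite cardfs_gt0; apply/fset0Pn; exists t.
have m2_gt0 : 0 < (m%:R ^+ 2)^-1 :> R by rewrite invr_gt0 exprn_gt0// ltr0n.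
pose ratio t n := ((rho R S (3 * n)) ^+ 2
  * (growth S (centralizer g `&` conj_set t (centralizer g)) (2 * n))%:R%:E
  / (growth S (centralizer g) n)%:R%:E)%E.
(* One n serves all t in the finite set T. *)
have [n hn] : exists n, forall t, t \in T ->
    (ratio t n < ((m%:R ^+ 2)^-1)%:E)%E /\ word_ball S n (t * g * t^-1)%g.
  have : \forall n \near \oo, (\bigcap_(t in [set` T]) [set n |
      (ratio t n < ((m%:R ^+ 2)^-1)%:E)%E /\ word_ball S n (t * g * t^-1)%g]) n.
    apply: filter_bigI => t tT; apply: filterI.
      have nbhs0 : nbhs (0%E : \bar R) [set y | (y < ((m%:R ^+ 2)^-1)%:E)%E].
        by apply: open_nbhs_nbhs; split; [exact: open_ereal_lt_ereal|].
      exact: (hlim t (Tg t tT) _ nbhs0).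
    have [L _ qL] : (\bigcup_n word_ball S n) (t * g * t^-1)%g by rewrite genS.
    by exists L => // n /= Ln; exact: word_ball_le qL.
  by case=> n _ /(_ n (leqnn n)) hn; exists n => t tT; exact: hn.
have C0 := centralizer_ball_neq0 g finS n.
pose hit t := [fset a in C n |
  (a * (t * g * t^-1) * a^-1)%g \in carrier H0]%fset.
have [t tT hit_t] : exists2 t, t \in T & (#|` C n| <= m * #|` hit t|)%N.
  apply: contrapT => nT.
  have sub : (C n `<=` \bigcup_(t <- T) hit t)%fset.
    apply/fsubsetP => a aC; have /(in_centralizer_ball _ finS)[ag _] := aC.
    have [t tT Ht] := hT a ag; apply/bigfcupP; exists t; first by rewrite tT.
    by rewrite !inE aC; exact/mem_set.
  have : (m * #|` C n| <= m * #|` C n|.-1)%N.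
    apply: leq_trans (leq_mul (leqnn m) (fsubset_leq_card sub)) _.
    apply: card_bigfcup_le => t tT; rewrite -ltnS prednK ?cardfs_gt0//.
    by rewrite ltnNge; apply/negP => ?; apply: nT; exists t.
  by rewrite leq_pmul2l// leqNgt prednK ?cardfs_gt0// leqnn.
have [ratio_lt qn] := hn t tT.
set q := (t * g * t^-1)%g in qn.
pose M := growth S (centralizer g `&` conj_set t (centralizer g)) (2 * n).
have fiberM x : (#|` conj_fiber (C n) q x| <= M)%N.
  exact: card_conj_fiber_centralizer_ball.
have M0 : (0 < M)%N.
  have [a aC] := fset0Pn _ C0; apply: leq_trans (fiberM (a * q * a^-1)%g).
  by rewrite cardfs_gt0; apply/fset0Pn; exists a; rewrite !inE aC eqxx.
have ball : [set` conjugates (C n) q] `<=` word_ball S (3 * n).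
  by rewrite !mulSn mul0n addn0 addnA; exact: conjugates_centralizer_ball.
have := rho_ge_conj_sum (amenK _ KH0) C0 M0 ball fiberM.
rewrite -/(hit t); set c := #|` C n|; set s := #|` hit t| => rho_ge.
have c0 : 0 < c%:R :> R by rewrite ltr0n cardfs_gt0.
have M0R : 0 < M%:R :> R by rewrite ltr0n.
have lower :
    (((s%:R / Num.sqrt (M * c)%:R) ^+ 2 * M%:R / c%:R)%:E <= ratio t n)%E.
  rewrite /ratio -/M -[growth _ (centralizer g) n]/c inver gt_eqF// EFinM.
  apply: lee_wpmul2r; first by rewrite lee_fin invr_ge0 ltW.
  rewrite EFinM; apply: lee_wpmul2r; first by rewrite lee_fin ltW.
  have x_ge0 : (0 <= (s%:R / Num.sqrt (M * c)%:R : R)%:E)%E.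
    by rewrite lee_fin divr_ge0 ?sqrtr_ge0.
  by rewrite expe2 expr2 EFinM; exact: lee_pmul.
have := le_lt_trans lower ratio_lt; rewrite lte_fin.
rewrite expr_div_n sqr_sqrtr// natrM.
have -> : s%:R ^+ 2 / (M%:R * c%:R) * M%:R / c%:R = (s%:R / c%:R) ^+ 2 :> R.
  by field; rewrite !gt_eqF.
rewrite -exprVn ltNge lerXn2r ?nnegrE ?divr_ge0 ?invr_ge0//.
by rewrite ler_pdivlMr// mulrC ler_pdivrMr ?ltr0n// mulrC -natrM ler_nat.
Qed.
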